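(* Let $\lambda>1$, $\lambda'>1$, $h\ge h_0$, $h'\ge h_0'$ and let $\overline{\tau}_0<\tau_0$ be as in the context. Let $V_1,V_2\in C^{2,1}(\mathbb{R}\times(-\infty,\overline{\tau}_0])$ be solutions of (Y) in $\mathbb{R}\times(-\infty,\overline{\tau}_0)$ which satisfy $$f_{\lambda,\lambda',h,h'}(x,\tau)\le V_i(x,\tau)\le\overline{f}_{\lambda,\lambda',h,h'}(x,\tau)\quad\forall x\in\mathbb{R},\ \tau<\overline{\tau}_0,\ i=1,2.$$ Then $V_1=V_2$ in $\mathbb{R}\times(-\infty,\overline{\tau}_0]$.
   Context: Fix an integer $n\ge3$ and put $m=\frac{n-2}{n+2}$, $p=\frac1m=\frac{n+2}{n-2}$. Equation (Y) is $v_\tau=(v^m)_{xx}+v-v^m$, $v>0$, for functions $v(x,\tau)$ of one space variable; a solution is a positive classical solution. $C^{2,1}$ means that $v,v_x,v_{xx},v_\tau$ are continuous. A subsolution of (Y) in $\mathbb{R}\times(\tau_1,\tau_2)$ is a positive bounded continuous function $v$ there such that for all $\tau_1<\tau_3<\tau_4<\tau_2$, $R>0$ and all $0\le\eta\in C^{2,1}([-R,R]\times[\tau_3,\tau_4])$ vanishing at $x=\pm R$, $$\int_{-R}^Rv\eta\,dx\Big|_{\tau_4}\le\int_{\tau_3}^{\tau_4}\!\!\int_{-R}^R[v\eta_\tau+v^m\eta_{xx}+(v-v^m)\eta]\,dx\,d\tau-\int_{\tau_3}^{\tau_4}\Big[v^m\eta_x\Big]_{x=-R}^{x=R}d\tau+\int_{-R}^Rv\eta\,dx\Big|_{\tau_3}.$$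 For $\lambda>1$, $v_\lambda$ denotes the solution of $(v^m)_{xx}+\lambda v_x+v-v^m=0$, $v>0$ in $\mathbb{R}$, with $v_\lambda(0)=\frac12$, $\lim_{x\to-\infty}v_\lambda(x)=0$, $\lim_{x\to\infty}v_\lambda(x)=1$. It is known to exist, $e^{-px}v_\lambda(x)$ tends to a positive constant as $x\to-\infty$, and $v_\lambda(x)=1-C_\lambda e^{-\gamma_\lambda x}+o(e^{-\gamma_\lambda x})$ as $x\to\infty$ for some $C_\lambda>0$, with $\gamma_\lambda=\frac{\lambda p-\sqrt{\lambda^2p^2-4(p-1)}}{2}$. Put $v_{\lambda,h}(x,\tau)=v_\lambda(x-\lambda\tau+h)$ and $\overline{v}_{\lambda',h'}(x,\tau)=v_{\lambda'}(-x-\lambda'\tau+h')$. Constants $k_0>0$, $h_0,h_0'\in\mathbb{R}$ are fixed, and $\tau_0'\in\mathbb{R}$ is chosen with $k_0e^{\frac{p-1}{p}\tau_0'}<\frac12$. For $\tau\le\tau_0'$, $$f(\tau)=\tau\bigl(1+qe^{\frac{p-1}{p}\tau}\bigr),$$ $$f_{\lambda,\lambda',h,h'}(x,\tau)=\bigl(v_{\lambda,h}(x,f(\tau))^{1-p}+\overline{v}_{\lambda',h'}(x,f(\tau))^{1-p}-1\bigr)^{-\frac1{p-1}},$$ $$\overline{f}_{\lambda,\lambda',h,h'}(x,\tau)=\min\bigl(v_{\lambda,h}(x,f(\tau)),\overline{v}_{\lambda',h'}(x,f(\tau))\bigr).$$ Here $q=q(p)>0$ and $\tau_0=\tau_0(h_0,h_0',k_0)<\min(\tau_0',-\frac{p}{p-1})$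 are fixed constants (existence part of the setting) such that $0<f'(\tau)<1$ for $\tau\le\tau_0$ and $f_{\lambda,\lambda',h,h'}$ is a subsolution of (Y) in $\mathbb{R}\times(-\infty,\tau_0)$ for all $\lambda,\lambda'>1$, $h\ge h_0$, $h'\ge h_0'$. $\overline{\tau}_0<\tau_0$ (so $\overline{\tau}_0<0$) is a constant such that for every $\tau\le\overline{\tau}_0$ there is a unique $x(\tau)\in\mathbb{R}$ such that $\overline{f}_{\lambda,\lambda',h,h'}(x,\tau)$ equals $v_{\lambda,h}(x,f(\tau))$ for $x\le x(\tau)$ and $\overline{v}_{\lambda',h'}(x,f(\tau))$ for $x\ge x(\tau)$. *)

(* Defs.v *)
From Stdlib Require Import Reals.
From Coquelicot Require Import Coquelicot.
Open Scope R_scope.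

Definition mexp (n : nat) : R := (INR n - 2) / (INR n + 2).
Definition pexp (n : nat) : R := / mexp n.

(* Functions of (x, tau) are curried, and a space-time domain is a product
   X x T of two subsets of R. *)
Definition whole_line : R -> Prop := fun _ => True.
Definition open_times (t1 t2 : Rbar) : R -> Prop :=
  fun t => Rbar_lt t1 t /\ Rbar_lt t t2.
Definition closed_interval (a b : R) : R -> Prop := fun x => a <= x <= b.

Definition jointly_continuous_on (X T : R -> Prop) (v : R -> R -> R) : Prop :=
  continuous_on (fun z : R * R => X (fst z) /\ T (snd z))
                (fun z : R * R => v (fst z) (snd z)).

(* The derivatives are taken relative to X and T ([D_in]), hence are one-sided
   at those endpoints of X or T that belong to the domain. *)
Definition C21_with (X T : R -> Prop) (v vx vxx vt : R -> R -> R) : Prop :=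
  (forall x t, X x -> T t ->
     D_in (fun y => v y t) (fun y => vx y t) X x /\
     D_in (fun y => vx y t) (fun y => vxx y t) X x /\
     D_in (fun s => v x s) (fun s => vt x s) T t) /\
  jointly_continuous_on X T v /\
  jointly_continuous_on X T vx /\
  jointly_continuous_on X T vxx /\
  jointly_continuous_on X T vt.

Definition C21 (X T : R -> Prop) (v : R -> R -> R) : Prop :=
  exists vx vxx vt, C21_with X T v vx vxx vt.

Definition solutionY (m : R) (t1 t2 : Rbar) (v : R -> R -> R) : Prop :=
  C21 whole_line (open_times t1 t2) v /\
  forall x t, open_times t1 t2 t ->
    0 < v x t /\
    Derive (fun s => v x s) t =
      Derive_n (fun y => Rpower (v y t) m) 2 x + v x t - Rpower (v x t) m.

Definition subsolutionY (m : R) (t1 t2 : Rbar) (v : R -> R -> R) : Prop :=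
  (forall x t, open_times t1 t2 t -> 0 < v x t) /\
  (exists M, forall x t, open_times t1 t2 t -> v x t <= M) /\
  jointly_continuous_on whole_line (open_times t1 t2) v /\
  forall (t3 t4 r : R) (eta etax etaxx etat : R -> R -> R),
    Rbar_lt t1 t3 -> t3 < t4 -> Rbar_lt t4 t2 -> 0 < r ->
    C21_with (closed_interval (- r) r) (closed_interval t3 t4)
             eta etax etaxx etat ->
    (forall x t, closed_interval (- r) r x -> closed_interval t3 t4 t ->
       0 <= eta x t) ->
    (forall t, closed_interval t3 t4 t -> eta (- r) t = 0 /\ eta r t = 0) ->
    RInt (fun x => v x t4 * eta x t4) (- r) r <=
      RInt (fun t =>
        RInt (fun x => v x t * etat x t + Rpower (v x t) m * etaxx x t
                       + (v x t - Rpower (v x t) m) * eta x t) (- r) r) t3 t4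
      - RInt (fun t => Rpower (v r t) m * etax r t
                       - Rpower (v (- r) t) m * etax (- r) t) t3 t4
      + RInt (fun x => v x t3 * eta x t3) (- r) r.

Definition travelling_wave (m l : R) (v : R -> R) : Prop :=
  (forall x, ex_derive v x /\ ex_derive_n v 2 x /\
             continuous (Derive_n v 2) x) /\
  (forall x, 0 < v x /\
     Derive_n (fun y => Rpower (v y) m) 2 x + l * Derive v x
       + v x - Rpower (v x) m = 0) /\
  v 0 = 1 / 2 /\
  is_lim v m_infty 0 /\
  is_lim v p_infty 1.

Definition wave_gamma (p l : R) : R :=
  (l * p - sqrt (l ^ 2 * p ^ 2 - 4 * (p - 1))) / 2.

(* e^(-p x) v(x) tends to a positive constant at -oo, and
   v(x) = 1 - C e^(-gamma x) + o(e^(-gamma x)) at +oo for some C > 0. *)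
Definition wave_asymptotics (p l : R) (v : R -> R) : Prop :=
  (exists A, 0 < A /\ is_lim (fun x => exp (- p * x) * v x) m_infty A) /\
  (exists C, 0 < C /\
     is_lim (fun x => (v x - (1 - C * exp (- wave_gamma p l * x)))
                      / exp (- wave_gamma p l * x)) p_infty 0).

Definition right_wave (w : R -> R -> R) (l h x t : R) : R :=
  w l (x - l * t + h).
Definition left_wave (w : R -> R -> R) (l' h' x t : R) : R :=
  w l' (- x - l' * t + h').

Definition ftime (p q t : R) : R := t * (1 + q * exp ((p - 1) / p * t)).

Definition flower (p q : R) (w : R -> R -> R) (l l' h h' x t : R) : R :=
  Rpower (Rpower (right_wave w l h x (ftime p q t)) (1 - p)
          + Rpower (left_wave w l' h' x (ftime p q t)) (1 - p) - 1)
         (- (1 / (p - 1))).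

Definition fupper (p q : R) (w : R -> R -> R) (l l' h h' x t : R) : R :=
  Rmin (right_wave w l h x (ftime p q t)) (left_wave w l' h' x (ftime p q t)).

(* Main.v *)
Require Import Defs.
From Stdlib Require Import Reals Lra Lia.
From Coquelicot Require Import Coquelicot.
Open Scope R_scope.

(** The proof compares a growth rate with a decay rate in [L^1].

    Where solutions are at most [1], the reaction term [v - v^m] has slope at
    most [a = 1 - m = (p - 1) / p], while the diffusion contracts the [L^1]
    distance.  So [exp (- a t) * int |V1 - V2|] does not increase.  As neither
    integrability nor decay of the solutions is assumed, the integral carries
    a cutoff of width [r]; since [V1^m] and [V2^m] are bounded, the cutoff
    costs only [O(1 / r)] per unit of time ([weighted_contraction]), which
    disappears as [r -> oo].

    Conversely, the squeeze between the two given functions bounds [|V1 - V2|]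
    by their difference.  Left of the point [x0] where the two waves are
    equally close to [1] the difference is controlled by [1 - v_l'], right of
    it by [1 - v_l].  At time [s] both quantities are [O(exp (k s))] at [x0]
    and decay exponentially away from it ([squeezed_gap_bound]), where, with
    [g = gamma_l] and [g' = gamma_l'],
      [k = g g' (l + l') / (g + g') = (g g' + p - 1) / p > a]
    ([interaction_rate_gt]).  Hence [exp (- a s) * int |V1 - V2|] is
    [O(exp ((k - a) s))] and tends to [0] as [s -> -oo]; since it bounds the
    same expression at every later time, [V1 = V2] ([ancient_uniqueness]).

    That the solutions are at most [1] also follows from the squeeze.  If a
    wave took a value [A > 1], then at very negative times it would take it at
    a point where the other wave [b] is almost [1], and there
    [(A^(1-p) + b^(1-p) - 1)^(-1/(p-1)) > b], so that the lower bound would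
    exceed the upper one ([glue_le_forces_le_1]). *)

(** * Continuity, exponentials and powers *)

Lemma cont_plus (f g : R -> R) x :
  continuous f x -> continuous g x -> continuous (fun y => f y + g y) x.
Proof. intros Hf Hg; exact (continuous_plus f g x Hf Hg). Qed.

Lemma cont_minus (f g : R -> R) x :
  continuous f x -> continuous g x -> continuous (fun y => f y - g y) x.
Proof. intros Hf Hg; exact (continuous_minus f g x Hf Hg). Qed.

Lemma cont_mult (f g : R -> R) x :
  continuous f x -> continuous g x -> continuous (fun y => f y * g y) x.
Proof. intros Hf Hg; exact (continuous_mult f g x Hf Hg). Qed.

Lemma cont_abs (f : R -> R) x :
  continuous f x -> continuous (fun y => Rabs (f y)) x.
Proof. intros Hf; exact (continuous_comp f Rabs x Hf (continuous_Rabs _)). Qed.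

Lemma is_derive_cont (f : R -> R) x l : is_derive f x l -> continuous f x.
Proof. intros H; apply (ex_derive_continuous (V := R_NormedModule)); now exists l. Qed.

Lemma exp_mono x y : x <= y -> exp x <= exp y.
Proof. intros [H | ->]; [now apply Rlt_le, exp_increasing | apply Rle_refl]. Qed.

Lemma Rpower_base_1 k : Rpower 1 k = 1.
Proof. unfold Rpower; rewrite ln_1, Rmult_0_r; apply exp_0. Qed.

(** * A regularized sign and Kato's inequality with a cutoff *)

Definition smooth_abs (mu s : R) : R := sqrt (s * s + mu * mu).

Lemma smooth_abs_pos mu s : 0 < mu -> 0 < smooth_abs mu s.
Proof. intros H; apply sqrt_lt_R0; nra. Qed.

Lemma smooth_abs_sq mu s : smooth_abs mu s * smooth_abs mu s = s * s + mu * mu.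
Proof. apply sqrt_sqrt; nra. Qed.

Lemma smooth_abs_bounds mu s :
  0 < mu -> Rabs s <= smooth_abs mu s <= Rabs s + mu.
Proof.
  intros H.
  assert (P := smooth_abs_pos mu s H); assert (Q := smooth_abs_sq mu s).
  assert (Rabs s * Rabs s = s * s) by (unfold Rabs; destruct Rcase_abs; ring).
  assert (0 <= Rabs s) by apply Rabs_pos.
  split; nra.
Qed.

Lemma is_derive_smooth_abs mu s :
  0 < mu -> is_derive (smooth_abs mu) s (s / smooth_abs mu s).
Proof.
  intros H; assert (P := smooth_abs_pos mu s H).
  unfold smooth_abs in *; auto_derive.
  - nra.
  - field; lra.
Qed.

Lemma is_derive_smooth_sign mu s : 0 < mu ->
  is_derive (fun z => z / smooth_abs mu z) s (mu * mu / smooth_abs mu s ^ 3).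
Proof.
  intros H; assert (P := smooth_abs_pos mu s H); assert (Q := smooth_abs_sq mu s).
  evar_last.
  - apply (is_derive_div (fun z => z) (smooth_abs mu)).
    + apply (is_derive_id (K := R_AbsRing)).
    + now apply is_derive_smooth_abs.
    + lra.
  - change (@one R_AbsRing) with 1.
    replace (mu * mu) with (smooth_abs mu s * smooth_abs mu s - s * s) by lra.
    field; lra.
Qed.

(** A polynomial on [[- r, r]] that vanishes together with its derivative at
    both endpoints, so that two integrations by parts against it leave no
    boundary terms. *)
Definition cutoff (r x : R) : R := (1 - x / r * (x / r)) ^ 2.

Lemma cutoff_bounds r x : 0 < r -> - r <= x <= r -> 0 <= cutoff r x <= 1.
Proof.
  intros Hr Hx; unfold cutoff.
  assert (x / r * r = x) by (field; lra).
  assert (-1 <= x / r <= 1) by (split; nra).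
  assert (0 <= x / r * (x / r) <= 1) by nra.
  simpl; split; nra.
Qed.

Lemma cutoff_half r x : 0 < r -> - r <= 2 * x <= r -> 1 / 2 <= cutoff r x.
Proof.
  intros Hr Hx; unfold cutoff.
  assert (x / r * r = x) by (field; lra).
  assert (-1 / 2 <= x / r <= 1 / 2) by (split; nra).
  assert (0 <= x / r * (x / r) <= 1 / 4) by nra.
  simpl; nra.
Qed.

Definition cutoff' (r x : R) : R := - 4 * x / r ^ 2 * (1 - x / r * (x / r)).
Definition cutoff'' (r x : R) : R := - 4 / r ^ 2 * (1 - 3 * (x / r * (x / r))).

Lemma is_derive_cutoff r x : 0 < r -> is_derive (cutoff r) x (cutoff' r x).
Proof. intros Hr; unfold cutoff, cutoff'; auto_derive; [lra | field; lra]. Qed.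

Lemma is_derive_cutoff' r x : 0 < r -> is_derive (cutoff' r) x (cutoff'' r x).
Proof. intros Hr; unfold cutoff', cutoff''; auto_derive; [lra | field; lra]. Qed.

Lemma continuous_cutoff r x : 0 < r -> continuous (cutoff r) x.
Proof. intros; eapply is_derive_cont, is_derive_cutoff; auto. Qed.

Lemma continuous_cutoff'' r x : 0 < r -> continuous (cutoff'' r) x.
Proof.
  intros; apply (ex_derive_continuous (V := R_NormedModule)).
  unfold cutoff''; auto_derive; lra.
Qed.

Lemma cutoff''_le r x : 0 < r -> - r <= x <= r -> cutoff'' r x <= 8 / r ^ 2.
Proof.
  intros Hr Hx; unfold cutoff''.
  assert (x / r * r = x) by (field; lra).
  assert (-1 <= x / r <= 1) by (split; nra).
  assert (0 < / r ^ 2) by (apply Rinv_0_lt_compat; nra).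
  assert (0 <= x / r * (x / r) <= 1) by nra.
  unfold Rdiv at 1 4; nra.
Qed.

(** Kato's inequality: with [A = smooth_abs mu], convexity of [A] gives
    [A'(W) W'' <= (A(W))''], and integrating the right-hand side twice by parts
    puts both derivatives on the cutoff.  The constant is the length [2 r]
    times [sup (cutoff'') <= 8 / r ^ 2] times [sup A(W) <= 1 + mu]. *)
Lemma kato_cutoff (W W1 W2 : R -> R) (r mu : R) :
  0 < r -> 0 < mu ->
  (forall x, is_derive W x (W1 x)) ->
  (forall x, is_derive W1 x (W2 x)) ->
  (forall x, continuous W2 x) ->
  (forall x, Rabs (W x) <= 1) ->
  RInt (fun x => W x / smooth_abs mu (W x) * W2 x * cutoff r x) (- r) r
  <= 16 * (1 + mu) / r.
Proof.
  intros Hr Hmu H1 H2 C2 HW.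
  set (S := fun x => W x / smooth_abs mu (W x)).
  set (S' := fun x => W1 x * (mu * mu / smooth_abs mu (W x) ^ 3)).
  set (A := fun x => smooth_abs mu (W x)).
  assert (dS : forall x, is_derive S x (S' x)).
  { intros x; apply (is_derive_comp (fun z => z / smooth_abs mu z) W);
      [now apply is_derive_smooth_sign | apply H1]. }
  assert (dA : forall x, is_derive A x (W1 x * S x)).
  { intros x; apply (is_derive_comp (smooth_abs mu) W);
      [now apply is_derive_smooth_abs | apply H1]. }
  assert (cW1 : forall x, continuous W1 x)
    by (intros; eapply is_derive_cont, H2).
  assert (cS : forall x, continuous S x) by (intros; eapply is_derive_cont, dS).
  assert (cA : forall x, continuous A x) by (intros; eapply is_derive_cont, dA).
  assert (cS' : forall x, continuous S' x).
  { intros x; apply cont_mult; [apply cW1 |].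
    apply (continuous_comp W (fun s => mu * mu / smooth_abs mu s ^ 3)).
    - eapply is_derive_cont, H1.
    - apply (ex_derive_continuous (V := R_NormedModule)).
      assert (P := smooth_abs_pos mu (W x) Hmu).
      unfold smooth_abs in *; auto_derive; split; [nra | split; [|easy]].
      apply Rgt_not_eq; repeat apply Rmult_lt_0_compat; lra. }
  (* [F = (A(W))' cutoff - A(W) cutoff'] vanishes at both endpoints; in [F'] the
     first term is the one that convexity makes nonnegative. *)
  set (F := fun x => S x * W1 x * cutoff r x - A x * cutoff' r x).
  set (F' := fun x => S' x * W1 x * cutoff r x + S x * W2 x * cutoff r x
                      - A x * cutoff'' r x).
  assert (dF : forall x, is_derive F x (F' x)).
  { intros x; unfold F, F'.
    evar_last.
    - apply (is_derive_minus (fun x => S x * W1 x * cutoff r x) (fun x => A x * cutoff' r x)).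
      + apply (is_derive_mult (fun x => S x * W1 x) (cutoff r)); [| now apply is_derive_cutoff | exact Rmult_comm].
        apply (is_derive_mult S W1); [apply dS | apply H2 | exact Rmult_comm].
      + apply (is_derive_mult A (cutoff' r)); [apply dA | now apply is_derive_cutoff' | exact Rmult_comm].
    - unfold minus, plus, opp, mult; simpl; ring. }
  assert (cF : forall x, continuous F' x).
  { intros x; unfold F'.
    assert (cc := continuous_cutoff r x Hr); assert (cc2 := continuous_cutoff'' r x Hr).
    apply cont_minus; [apply cont_plus |].
    - apply cont_mult; [apply cont_mult; [apply cS' | apply cW1] | exact cc].
    - apply cont_mult; [apply cont_mult; [apply cS | apply C2] | exact cc].
    - apply cont_mult; [apply cA | exact cc2]. }
  assert (IF := is_RInt_derive F F' (- r) r (fun x _ => dF x) (fun x _ => cF x)).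
  assert (E0 : minus (F r) (F (- r)) = 0).
  { unfold minus, plus, opp, F, cutoff, cutoff'; simpl; field; lra. }
  change (is_RInt F' (- r) r (minus (F r) (F (- r)))) in IF; rewrite E0 in IF.
  set (K := 8 * (1 + mu) / r ^ 2).
  assert (IK := is_RInt_plus F' (fun _ => K) (- r) r _ _ IF (is_RInt_const (- r) r K)).
  replace (16 * (1 + mu) / r) with (plus 0 (scal (r - - r) K)).
  2:{ unfold plus, scal, K; simpl; unfold mult; simpl; field; lra. }
  eapply is_RInt_le; [ | | exact IK | ].
  - lra.
  - apply (RInt_correct (V := R_CompleteNormedModule)).
    apply (ex_RInt_continuous (V := R_CompleteNormedModule)); intros z _.
    change (continuous (fun x => S x * W2 x * cutoff r x) z).
    apply cont_mult; [apply cont_mult; [apply cS | apply C2] | now apply continuous_cutoff].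
  - intros x Hx.
    change (S x * W2 x * cutoff r x <= F' x + K).
    assert (Hc := cutoff_bounds r x Hr ltac:(lra)).
    assert (Hc2 := cutoff''_le r x Hr ltac:(lra)).
    assert (PA := smooth_abs_pos mu (W x) Hmu).
    assert (BA := smooth_abs_bounds mu (W x) Hmu).
    assert (0 <= S' x * W1 x).
    { unfold S'.
      assert (0 <= mu * mu / smooth_abs mu (W x) ^ 3).
      { apply Rle_mult_inv_pos; [nra | now apply pow_lt]. }
      nra. }
    specialize (HW x).
    assert (A x * cutoff'' r x <= K).
    { apply Rle_trans with (A x * (8 / r ^ 2)).
      - apply Rmult_le_compat_l; [unfold A; lra | easy].
      - assert (0 < / r ^ 2) by (apply Rinv_0_lt_compat; nra).
        unfold K, A, Rdiv; nra. }
    unfold F'; nra.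
Qed.

(** * Comparing a solution with its power *)

(** The slope of [z^m] is at least [m] on [(0, 1]]. *)
Lemma Rpower_increment_ge m x y :
  0 < m < 1 -> 0 < x -> x <= y -> y <= 1 ->
  m * (y - x) <= Rpower y m - Rpower x m.
Proof.
  intros Hm Hx Hxy Hy.
  destruct Hxy as [Hxy | ->]; [| lra].
  destruct (MVT_cor2 (fun z => Rpower z m) (fun z => m * Rpower z (m - 1)) x y Hxy)
    as [c [E Hc]].
  { intros c Hc; apply derivable_pt_lim_power; lra. }
  rewrite E.
  assert (1 <= Rpower c (m - 1)).
  { assert (ln c <= 0) by (rewrite <- ln_1; apply ln_le; lra).
    assert (L := exp_ineq1_le ((m - 1) * ln c)); unfold Rpower; nra. }
  assert (0 < m * (y - x)) by nra.
  nra.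
Qed.

Lemma power_gap_compare m x y :
  0 < m < 1 -> 0 < x <= 1 -> 0 < y <= 1 ->
  0 <= (Rpower x m - Rpower y m) * (x - y) /\
  m * Rabs (x - y) <= Rabs (Rpower x m - Rpower y m).
Proof.
  intros Hm Hx Hy.
  destruct (Rle_dec x y) as [H | H].
  - assert (B := Rpower_increment_ge m x y Hm ltac:(lra) H ltac:(lra)).
    assert (0 <= m * (y - x)) by nra.
    rewrite !Rabs_left1 by lra; split; nra.
  - assert (B := Rpower_increment_ge m y x Hm ltac:(lra) ltac:(lra) ltac:(lra)).
    assert (0 <= m * (x - y)) by nra.
    rewrite !Rabs_right by lra; split; nra.
Qed.

(** The error made by replacing [|D|] with the regularized sign of [W] times
    [D]: it is bounded by [mu / m] whatever [D] and [W] are, because where the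
    regularized sign is far from the true one [|W|], hence [|D|], is small. *)
Lemma smooth_sign_defect m mu D W :
  0 < m -> 0 < mu -> 0 <= W * D -> m * Rabs D <= Rabs W ->
  Rabs D - W / smooth_abs mu W * D <= mu / m.
Proof.
  intros Hm Hmu Hs Hc.
  assert (P := smooth_abs_pos mu W Hmu).
  destruct (smooth_abs_bounds mu W Hmu) as [B1 B2].
  set (A := smooth_abs mu W) in *.
  assert (E : W * D = Rabs W * Rabs D) by (rewrite <- Rabs_mult, Rabs_pos_eq; auto).
  replace (Rabs D - W / A * D) with ((A - Rabs W) * (m * Rabs D) / (m * A)).
  2:{ replace (W / A * D) with (W * D / A) by (field; lra). rewrite E; field; lra. }
  apply Rmult_le_reg_r with (m * A); [nra |].
  replace ((A - Rabs W) * (m * Rabs D) / (m * A) * (m * A)) with ((A - Rabs W) * (m * Rabs D)) by (field; lra).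
  replace (mu / m * (m * A)) with (mu * A) by (field; lra).
  assert (0 <= Rabs D) by apply Rabs_pos.
  assert (0 <= m * Rabs D) by nra.
  apply Rmult_le_compat; lra.
Qed.

(** This is where the rate [1 - m] comes from: for [D = v1 - v2] and
    [W = v1^m - v2^m], the reaction [D - W] differs from [(1 - m) D] by
    [m D - W], whose sign is opposite to that of [W]. *)
Lemma smooth_sign_reaction m mu D W :
  0 < m -> 0 < mu -> m * Rabs D <= Rabs W ->
  W / smooth_abs mu W * (m * D - W) <= 0.
Proof.
  intros Hm Hmu Hc.
  assert (P := smooth_abs_pos mu W Hmu).
  replace (W / smooth_abs mu W * (m * D - W))
    with (- ((W * W - m * (W * D)) / smooth_abs mu W)) by (field; lra).
  assert (E : W * D <= Rabs W * Rabs D) by (rewrite <- Rabs_mult; apply Rle_abs).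
  assert (E' : W * W = Rabs W * Rabs W) by (unfold Rabs; destruct Rcase_abs; ring).
  assert (0 <= Rabs W) by apply Rabs_pos.
  assert (0 <= (W * W - m * (W * D)) / smooth_abs mu W).
  { apply Rle_mult_inv_pos; [nra | easy]. }
  lra.
Qed.

(** * Regularity of solutions *)

Lemma open_times_locally t1 t2 t :
  open_times t1 t2 t -> locally t (open_times t1 t2).
Proof.
  intros [H1 H2]; apply filter_and.
  - exact (open_Rbar_gt' t t1 H1).
  - exact (open_Rbar_lt' t t2 H2).
Qed.

Lemma open_times_between t1 t2 s T t :
  open_times t1 t2 s -> open_times t1 t2 T -> s <= t <= T -> open_times t1 t2 t.
Proof.
  intros [H1 _] [_ H2] Ht; split.
  - apply Rbar_lt_le_trans with (Finite s); [easy | apply Ht].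
  - apply Rbar_le_lt_trans with (Finite T); [apply Ht | easy].
Qed.

Lemma D_in_locally_is_derive f df (D : R -> Prop) x :
  locally x D -> D_in f df D x -> is_derive f x (df x).
Proof.
  intros [d Hd] H.
  apply is_derive_Reals, derivable_pt_lim_D_in.
  intros eps Heps; destruct (H eps Heps) as [a [Ha H']].
  exists (Rmin a d); split; [apply Rmin_pos; [easy | apply cond_pos] |].
  intros y [[_ Hy] Hd']; apply H'.
  assert (B1 := Rmin_l a d); assert (B2 := Rmin_r a d).
  split; [split |]; [| exact Hy | simpl in *; lra].
  apply Hd; change (Rabs (y - x) < d); simpl in Hd'; unfold Rdist in Hd'; lra.
Qed.

Lemma continuity_2d_of_jointly t1 t2 v x t :
  jointly_continuous_on whole_line (open_times t1 t2) v ->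
  open_times t1 t2 t -> continuity_2d_pt v x t.
Proof.
  intros H Ht; apply continuity_2d_pt_filterlim.
  refine (continuous_continuous_on _ _ (x, t) _ H).
  destruct (open_times_locally _ _ _ Ht) as [d Hd].
  exists d; intros [y s] [_ Hs]; split; [exact I | apply Hd, Hs].
Qed.

Lemma continuity_2d_slice v x t :
  continuity_2d_pt v x t -> continuous (fun y => v y t) x.
Proof.
  intros H; apply continuity_2d_pt_filterlim in H.
  refine (filterlim_comp _ _ _ (fun y => (y, t)) _ _ _ _ _ H).
  intros P [d Hd]; exists d; intros y Hy; apply Hd; split;
    [exact Hy | apply ball_center].
Qed.

(** The equation is used to express the second space derivative of [v^m], which
    makes the continuity of that derivative a consequence of the continuity of
    [v] and [v_t]. *)
Lemma solutionY_regular m t1 t2 v :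
  solutionY m t1 t2 v ->
  exists vt ux : R -> R -> R,
    (forall x t, open_times t1 t2 t ->
       continuity_2d_pt v x t /\ continuity_2d_pt vt x t /\
       is_derive (fun s => v x s) t (vt x t)) /\
    (forall x t, open_times t1 t2 t ->
       is_derive (fun y => Rpower (v y t) m) x (ux x t) /\
       is_derive (fun y => ux y t) x (vt x t - v x t + Rpower (v x t) m)).
Proof.
  intros [[vx [vxx [vt [HD [Hc [_ [_ Hct]]]]]]] Heq].
  assert (Dt : forall x t, open_times t1 t2 t -> is_derive (fun s => v x s) t (vt x t)).
  { intros x t Ht; apply (D_in_locally_is_derive _ (fun s => vt x s) (open_times t1 t2)).
    - now apply open_times_locally.
    - now apply HD. }
  assert (Lx : forall x : R, locally x whole_line) by (intros; now apply filter_forall).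
  set (ux := fun x t => m * Rpower (v x t) (m - 1) * vx x t).
  exists vt, ux; split.
  { intros x t Ht; split; [| split].
    - now apply (continuity_2d_of_jointly t1 t2).
    - now apply (continuity_2d_of_jointly t1 t2).
    - now apply Dt. }
  intros x t Ht.
  assert (Dx : forall y, is_derive (fun y => v y t) y (vx y t)).
  { intros y; apply (D_in_locally_is_derive _ (fun y => vx y t) whole_line); [apply Lx | now apply HD]. }
  assert (Dxx : forall y, is_derive (fun y => vx y t) y (vxx y t)).
  { intros y; apply (D_in_locally_is_derive _ (fun y => vxx y t) whole_line); [apply Lx | now apply HD]. }
  assert (Pow : forall k y, is_derive (fun y => Rpower (v y t) k) y (k * Rpower (v y t) (k - 1) * vx y t)).
  { intros k y; rewrite Rmult_comm.
    apply (is_derive_comp (fun z => Rpower z k) (fun y => v y t)); [| apply Dx].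
    apply is_derive_Reals, derivable_pt_lim_power, Heq, Ht. }
  split; [apply Pow |].
  assert (E2 : Derive_n (fun y => Rpower (v y t) m) 2 x = Derive (fun y => ux y t) x).
  { simpl; apply Derive_ext; intros y; apply is_derive_unique, Pow. }
  destruct (Heq x t Ht) as [_ E].
  assert (Et : Derive (fun s => v x s) t = vt x t) by now apply is_derive_unique, Dt.
  rewrite Et, E2 in E.
  replace (vt x t - v x t + Rpower (v x t) m) with (Derive (fun y => ux y t) x) by lra.
  apply Derive_correct; unfold ux.
  eexists; apply (is_derive_mult (fun y => m * Rpower (v y t) (m - 1)) (fun y => vx y t));
    [| apply Dxx | exact Rmult_comm].
  apply (is_derive_scal (fun y => Rpower (v y t) (m - 1))), Pow.
Qed.

(** * Contraction in the weighted L^1 distance *)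

Lemma uniform_time_derivative (g gt : R -> R -> R) a b s T :
  (forall x t, a <= x <= b -> s <= t <= T ->
     is_derive (fun t => g x t) t (gt x t) /\ continuity_2d_pt gt x t) ->
  forall eps, 0 < eps -> exists delta, 0 < delta /\
    forall x t' t, a <= x <= b -> s <= t' -> t' < t -> t <= T -> t - t' < delta ->
      Rabs (g x t - g x t' - (t - t') * gt x t) <= (t - t') * eps.
Proof.
  intros H eps Heps.
  destruct (uniform_continuity_2d gt a b s T (fun x t Hx Ht => proj2 (H x t Hx Ht))
              (mkposreal eps Heps)) as [d Hd].
  exists d; split; [apply cond_pos |].
  intros x t' t Hx Hs Htt HT Hdel.
  destruct (MVT_cor2 (fun t => g x t) (fun t => gt x t) t' t Htt) as [c [E Hc]].
  { intros c Hc; apply is_derive_Reals, H; [easy | lra]. }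
  rewrite E.
  replace (gt x c * (t - t') - (t - t') * gt x t)
    with ((t - t') * (gt x c - gt x t)) by ring.
  rewrite Rabs_mult, (Rabs_pos_eq (t - t')) by lra.
  apply Rmult_le_compat_l; [lra |].
  apply Rlt_le, (Hd x t x c); try lra.
  - rewrite Rminus_diag, Rabs_R0; apply cond_pos.
  - rewrite Rabs_left; lra.
Qed.

(** Bounds on short increments add up along a subdivision; this replaces a
    differential inequality for functions that need not be differentiable. *)
Lemma increments_chain (G : R -> R) s T K delta :
  0 < delta -> s <= T ->
  (forall t' t, s <= t' -> t' < t -> t <= T -> t - t' < delta ->
     G t - G t' <= (t - t') * K) ->
  G T - G s <= (T - s) * K.
Proof.
  intros Hd [HsT | <-] H; [| lra].
  destruct (archimed_cor1 (delta / (T - s))) as [N [HN HN0]].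
  { apply Rdiv_lt_0_compat; lra. }
  assert (PN : 0 < INR N) by now apply lt_0_INR.
  set (d := (T - s) / INR N).
  assert (Hd' : d * INR N = T - s) by (unfold d; field; lra).
  assert (Pd : 0 < d) by (apply Rdiv_lt_0_compat; lra).
  assert (Hdd : d < delta).
  { unfold d; apply Rmult_lt_compat_r with (r := T - s) in HN; [| lra].
    replace (delta / (T - s) * (T - s)) with delta in HN by (field; lra).
    unfold Rdiv; lra. }
  assert (I : forall k, (k <= N)%nat -> G (s + INR k * d) - G s <= INR k * d * K).
  { induction k as [| k IH]; intros Hk.
    - simpl; replace (s + 0 * d) with s by ring; lra.
    - assert (Hk' : INR (S k) <= INR N) by now apply le_INR.
      assert (P0 : 0 <= INR k) by apply pos_INR.
      rewrite S_INR in *.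
      assert (B := H (s + INR k * d) (s + (INR k + 1) * d)
        ltac:(nra) ltac:(nra) ltac:(nra) ltac:(lra)).
      specialize (IH ltac:(lia)); nra. }
  specialize (I N (le_n N)).
  replace (s + INR N * d) with T in I by lra.
  replace (T - s) with (INR N * d) by lra; exact I.
Qed.

Definition weighted_gap (V1 V2 : R -> R -> R) (r t : R) : R :=
  RInt (fun x => Rabs (V1 x t - V2 x t) * cutoff r x) (- r) r.

Lemma weighted_gap_ex_RInt (V1 V2 : R -> R -> R) r t a b : 0 < r ->
  (forall x, continuous (fun y => V1 y t) x) ->
  (forall x, continuous (fun y => V2 y t) x) ->
  ex_RInt (fun x => Rabs (V1 x t - V2 x t) * cutoff r x) a b.
Proof.
  intros Hr C1 C2; apply (ex_RInt_continuous (V := R_CompleteNormedModule)).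
  intros z _; apply cont_mult; [apply cont_abs, cont_minus; auto | now apply continuous_cutoff].
Qed.

(** As [|D|] is not differentiable in time, the estimate is made on short time
    steps.  For any number [sg] with [|sg| <= 1], [|E(t')| >= sg E(t')], so
      [|E(t)| - |E(t')| <= (|E(t)| - sg E(t)) + sg (E(t) - E(t'))]
    where [E = exp (- (1 - m) t) D].  With [sg] the regularized sign of
    [W = V1^m - V2^m] at the later time [t], the first bracket is [O(mu)] and
    the second one is, up to a uniformly small error, [t - t'] times
    [sg E_t(t)], to which Kato's inequality applies because [sg] depends on [x]
    only through [W].  The parameter [mu] goes to [0] with the time step fixed,
    and then the step goes to [0]. *)
Lemma weighted_contraction m t1 t2 V1 V2 r s T :
  0 < m < 1 ->
  solutionY m t1 t2 V1 -> solutionY m t1 t2 V2 ->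
  (forall x t, open_times t1 t2 t -> V1 x t <= 1) ->
  (forall x t, open_times t1 t2 t -> V2 x t <= 1) ->
  0 < r -> open_times t1 t2 s -> open_times t1 t2 T -> s <= T ->
  exp (- (1 - m) * T) * weighted_gap V1 V2 r T
  - exp (- (1 - m) * s) * weighted_gap V1 V2 r s
  <= (T - s) * (exp (- (1 - m) * s) * (16 / r)).
Proof.
  intros Hm S1 S2 B1 B2 Hr Os OT HsT.
  assert (P1 : forall x t, open_times t1 t2 t -> 0 < V1 x t <= 1)
    by (intros x t Ht; split; [now apply S1 | now apply B1]).
  assert (P2 : forall x t, open_times t1 t2 t -> 0 < V2 x t <= 1)
    by (intros x t Ht; split; [now apply S2 | now apply B2]).
  destruct (solutionY_regular _ _ _ _ S1) as [v1t [u1x [R1 U1]]].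
  destruct (solutionY_regular _ _ _ _ S2) as [v2t [u2x [R2 U2]]].
  set (a := 1 - m).
  set (D := fun x t => V1 x t - V2 x t).
  set (W := fun x t => Rpower (V1 x t) m - Rpower (V2 x t) m).
  set (W2 := fun x t => v1t x t - v2t x t - (D x t - W x t)).
  set (e := fun t => exp (- a * t)).
  set (E := fun x t => e t * D x t).
  set (Et := fun x t => e t * (v1t x t - v2t x t - a * D x t)).
  assert (Oin : forall t, s <= t <= T -> open_times t1 t2 t)
    by (intros t Ht; now apply (open_times_between t1 t2 s T)).
  assert (Pe : forall t, 0 < e t) by (intros; apply exp_pos).
  assert (He : forall t, s <= t -> e t <= e s).
  { intros t [Ht | <-]; [| lra]; apply Rlt_le, exp_increasing; unfold a; nra. }
  assert (EtD : forall x t, open_times t1 t2 t ->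
    is_derive (fun t => E x t) t (Et x t) /\ continuity_2d_pt Et x t).
  { intros x t Ht.
    destruct (R1 x t Ht) as [C1 [C1t D1]]; destruct (R2 x t Ht) as [C2 [C2t D2]].
    assert (De : is_derive e t (- a * e t)).
    { unfold e; auto_derive; [easy | ring]. }
    split.
    - evar_last.
      + apply (is_derive_mult e (fun t => D x t)); [exact De | | exact Rmult_comm].
        apply (is_derive_minus (fun t => V1 x t) (fun t => V2 x t)); [exact D1 | exact D2].
      + unfold Et, minus, plus, opp, mult; simpl; ring.
    - apply continuity_2d_pt_mult.
      + apply (continuity_1d_2d_pt_comp e (fun _ t => t)); [| apply continuity_2d_pt_id2].
        apply continuity_pt_filterlim; exact (is_derive_cont _ _ _ De).
      + repeat apply continuity_2d_pt_minus; auto.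
        apply continuity_2d_pt_mult; [apply continuity_2d_pt_const |].
        now apply continuity_2d_pt_minus. }
  assert (cD : forall t, open_times t1 t2 t -> forall x, continuous (fun y => D y t) x).
  { intros t Ht x; apply cont_minus; apply continuity_2d_slice; [now apply R1 | now apply R2]. }
  assert (W_C2 : forall t, open_times t1 t2 t -> forall x,
    is_derive (fun y => W y t) x (u1x x t - u2x x t) /\
    is_derive (fun y => u1x y t - u2x y t) x (W2 x t) /\
    continuous (fun y => W2 y t) x).
  { intros t Ht x.
    destruct (U1 x t Ht) as [DU1 DU1']; destruct (U2 x t Ht) as [DU2 DU2'].
    assert (DW : is_derive (fun y => W y t) x (u1x x t - u2x x t)).
    { apply (is_derive_minus (fun y => Rpower (V1 y t) m) (fun y => Rpower (V2 y t) m));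
        assumption. }
    split; [exact DW |]; split.
    - evar_last.
      + apply (is_derive_minus (fun y => u1x y t) (fun y => u2x y t)); eassumption.
      + unfold W2, D, W, minus, plus, opp; simpl; ring.
    - apply cont_minus; [| apply cont_minus; [now apply cD | exact (is_derive_cont _ _ _ DW)]].
      apply cont_minus; apply continuity_2d_slice; [now apply R1 | now apply R2]. }
  assert (W_le : forall t, open_times t1 t2 t -> forall x, Rabs (W x t) <= 1).
  { intros t Ht x.
    assert (L : forall v, 0 < v <= 1 -> 0 < Rpower v m <= 1).
    { intros v Hv; split; [apply exp_pos |].
      unfold Rpower; rewrite <- exp_0.
      assert (ln v <= 0) by (rewrite <- ln_1; apply ln_le; lra).
      assert (Q : m * ln v <= 0) by nra.
      destruct Q as [Q | ->]; [apply Rlt_le, exp_increasing, Q | lra]. }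
    assert (L1 := L _ (P1 x t Ht)); assert (L2 := L _ (P2 x t Ht)).
    apply Rabs_le; unfold W; lra. }
  set (G := fun t => e t * weighted_gap V1 V2 r t).
  change (G T - G s <= (T - s) * (e s * (16 / r))).
  apply le_epsilon; intros eps Heps.
  set (eps1 := eps / (T - s + 1)).
  assert (Heps1 : 0 < eps1) by (apply Rdiv_lt_0_compat; lra).
  apply Rle_trans with ((T - s) * (e s * (16 / r) + eps1)).
  2:{ assert (eps1 * (T - s + 1) = eps) by (unfold eps1; field; lra). nra. }
  set (eps2 := eps1 / (2 * r)).
  assert (Heps2 : 0 < eps2) by (apply Rdiv_lt_0_compat; lra).
  destruct (uniform_time_derivative E Et (- r) r s T (fun x t _ Ht => EtD x t (Oin t Ht)) eps2 Heps2)
    as [delta [Hdel Hlin]].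
  apply increments_chain with delta; [easy | easy |].
  intros t' t Hst' Htt HtT Hd.
  assert (Ot : open_times t1 t2 t) by (apply Oin; lra).
  assert (Ot' : open_times t1 t2 t') by (apply Oin; lra).
  assert (P16 : 0 < 16 / r) by (apply Rdiv_lt_0_compat; lra).
  apply le_epsilon; intros eta Heta.
  (* [C * mu] collects all the terms proportional to [mu] in the estimate of one
     time step, so [mu] is chosen to make their sum [eta]. *)
  set (C := 2 * r * e t / m + (t - t') * e t * (16 / r)).
  assert (HC : 0 < C).
  { assert (0 < 2 * r * e t / m) by (apply Rdiv_lt_0_compat; [specialize (Pe t); nra | lra]).
    assert (0 < (t - t') * e t) by (specialize (Pe t); nra).
    unfold C; nra. }
  set (mu := eta / C).
  assert (Hmu : 0 < mu) by now apply Rdiv_lt_0_compat.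
  set (sg := fun x => W x t / smooth_abs mu (W x t)).
  assert (Hpt : forall x, - r < x < r ->
    e t * (Rabs (D x t) * cutoff r x) - e t' * (Rabs (D x t') * cutoff r x)
    <= (e t * (mu / m) + (t - t') * eps2)
       + (t - t') * e t * (sg x * W2 x t * cutoff r x)).
  { intros x Hx.
    destruct (power_gap_compare m _ _ Hm (P1 x t Ot) (P2 x t Ot)) as [Hsgn Hcmp].
    assert (Q1 := smooth_sign_defect m mu _ _ (proj1 Hm) Hmu Hsgn Hcmp).
    assert (Q2 := smooth_sign_reaction m mu _ _ (proj1 Hm) Hmu Hcmp).
    change (Rabs (D x t) - sg x * D x t <= mu / m) in Q1.
    change (sg x * (m * D x t - W x t) <= 0) in Q2.
    specialize (Hlin x t' t ltac:(lra) Hst' Htt HtT Hd).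
    assert (Hsg : Rabs (sg x) <= 1).
    { unfold sg; rewrite Rabs_div by (apply Rgt_not_eq, smooth_abs_pos, Hmu).
      assert (A0 := smooth_abs_pos mu (W x t) Hmu).
      rewrite (Rabs_pos_eq (smooth_abs mu (W x t))) by lra.
      apply Rle_div_l; [lra |].
      rewrite Rmult_1_l; now apply smooth_abs_bounds. }
    assert (Q3 : sg x * E x t' <= Rabs (E x t')).
    { apply Rle_trans with (Rabs (sg x * E x t')); [apply Rle_abs |].
      rewrite Rabs_mult; assert (0 <= Rabs (E x t')) by apply Rabs_pos; nra. }
    assert (Q4 : sg x * (E x t - E x t' - (t - t') * Et x t) <= (t - t') * eps2).
    { apply Rle_trans with (Rabs (sg x * (E x t - E x t' - (t - t') * Et x t)));
        [apply Rle_abs |].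
      rewrite Rabs_mult.
      set (z := Rabs (E x t - E x t' - (t - t') * Et x t)) in *.
      assert (0 <= z) by apply Rabs_pos; nra. }
    assert (AE : forall t, Rabs (E x t) = e t * Rabs (D x t)).
    { intros u; unfold E; rewrite Rabs_mult, (Rabs_pos_eq (e u)); [easy | apply Rlt_le, Pe]. }
    (* [Et = e (W2 + (m D - W))], and the reaction part has the good sign. *)
    assert (Q5 : sg x * Et x t <= e t * (sg x * W2 x t)).
    { replace (sg x * Et x t)
        with (e t * (sg x * W2 x t) + e t * (sg x * (m * D x t - W x t)))
        by (unfold Et, W2, a; ring).
      specialize (Pe t); nra. }
    assert (Q6 : e t * Rabs (D x t) - sg x * E x t <= e t * (mu / m)).
    { replace (e t * Rabs (D x t) - sg x * E x t)
        with (e t * (Rabs (D x t) - sg x * D x t)) by (unfold E; ring).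
      apply Rmult_le_compat_l; [apply Rlt_le, Pe | exact Q1]. }
    assert (Q7 : e t * Rabs (D x t) - e t' * Rabs (D x t')
      <= (e t * (mu / m) + (t - t') * eps2) + (t - t') * e t * (sg x * W2 x t)).
    { rewrite <- (AE t'); nra. }
    assert (Hc := cutoff_bounds r x Hr ltac:(lra)).
    assert (0 <= e t * (mu / m) + (t - t') * eps2).
    { assert (0 < mu / m) by (apply Rdiv_lt_0_compat; lra); specialize (Pe t); nra. }
    set (k := e t * (mu / m) + (t - t') * eps2) in *.
    apply Rle_trans with ((k + (t - t') * e t * (sg x * W2 x t)) * cutoff r x); nra. }
  assert (K := kato_cutoff (fun x => W x t) (fun x => u1x x t - u2x x t) (fun x => W2 x t)
    r mu Hr Hmu (fun x => proj1 (W_C2 t Ot x)) (fun x => proj1 (proj2 (W_C2 t Ot x)))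
    (fun x => proj2 (proj2 (W_C2 t Ot x))) (W_le t Ot)).
  set (J := RInt (fun x => W x t / smooth_abs mu (W x t) * W2 x t * cutoff r x) (- r) r) in K.
  assert (IJ : is_RInt (fun x => sg x * W2 x t * cutoff r x) (- r) r J).
  { apply (RInt_correct (V := R_CompleteNormedModule)).
    apply (ex_RInt_continuous (V := R_CompleteNormedModule)); intros x _.
    apply cont_mult; [apply cont_mult |].
    - apply (continuous_comp (fun x => W x t) (fun z => z / smooth_abs mu z)).
      + exact (is_derive_cont _ _ _ (proj1 (W_C2 t Ot x))).
      + eapply is_derive_cont, is_derive_smooth_sign, Hmu.
    - apply (W_C2 t Ot x).
    - now apply continuous_cutoff. }
  assert (IG : forall t, open_times t1 t2 t ->
    is_RInt (fun x => e t * (Rabs (D x t) * cutoff r x)) (- r) r (G t)).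
  { intros u Hu; apply (is_RInt_scal (V := R_NormedModule)).
    apply (RInt_correct (V := R_CompleteNormedModule)).
    apply weighted_gap_ex_RInt; [easy | |]; intros y; apply continuity_2d_slice;
      [now apply R1 | now apply R2]. }
  assert (Main : G t - G t' <= 2 * r * (e t * (mu / m) + (t - t') * eps2) + (t - t') * e t * J).
  { eapply is_RInt_le; [| | | exact Hpt].
    - lra.
    - apply (is_RInt_minus (V := R_NormedModule)); now apply IG.
    - replace (2 * r) with (r - - r) by ring.
      apply (is_RInt_plus (V := R_NormedModule)).
      + apply (is_RInt_const (V := R_NormedModule)).
      + apply (is_RInt_scal (V := R_NormedModule)), IJ. }
  assert (Hte : 0 < (t - t') * e t) by (specialize (Pe t); nra).
  assert (Main2 : (t - t') * e t * J <= (t - t') * e t * (16 / r) + (t - t') * e t * (16 / r) * mu).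
  { apply Rle_trans with ((t - t') * e t * (16 * (1 + mu) / r)).
    - apply Rmult_le_compat_l; lra.
    - right; field; lra. }
  assert (EC : C * mu = eta) by (unfold mu; field; lra).
  assert (E2 : 2 * r * (e t * (mu / m) + (t - t') * eps2) + (t - t') * e t * (16 / r) * mu
               = eta + (t - t') * eps1).
  { rewrite <- EC; unfold C, eps2; field; lra. }
  assert (He' := He t ltac:(lra)).
  assert ((t - t') * e t * (16 / r) <= (t - t') * (e s * (16 / r))).
  { rewrite Rmult_assoc; apply Rmult_le_compat_l; [lra | nra]. }
  lra.
Qed.

(** * Upper and lower bounds for the weighted distance *)

Lemma one_plus_sq_neq_0 z : 1 + z ^ 2 <> 0.
Proof. assert (H := pow2_ge_0 z); lra. Qed.

(** A Lorentzian profile has an explicit primitive and an integral that depends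
    neither on its centre [x0] nor on [r]. *)
Lemma weighted_gap_le (V1 V2 : R -> R -> R) r t N x0 :
  0 < r ->
  (forall x, continuous (fun y => V1 y t) x) ->
  (forall x, continuous (fun y => V2 y t) x) ->
  (forall x, Rabs (V1 x t - V2 x t) <= N / (1 + (x - x0) ^ 2)) ->
  weighted_gap V1 V2 r t <= N * PI.
Proof.
  intros Hr C1 C2 HN.
  set (f := fun x => N / (1 + (x - x0) ^ 2)).
  assert (If : is_RInt f (- r) r (minus (N * atan (r - x0)) (N * atan (- r - x0)))).
  { apply (is_RInt_derive (fun x => N * atan (x - x0)) f); intros x _.
    - unfold f; auto_derive; [easy |].
      unfold Rsqr; field; apply one_plus_sq_neq_0.
    - apply (ex_derive_continuous (V := R_NormedModule)).
      unfold f; auto_derive; apply one_plus_sq_neq_0. }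
  apply Rle_trans with (minus (N * atan (r - x0)) (N * atan (- r - x0))).
  - eapply is_RInt_le; [| | exact If |].
    + lra.
    + apply (RInt_correct (V := R_CompleteNormedModule)).
      now apply weighted_gap_ex_RInt.
    + intros x Hx; fold (f x).
      assert (Hc := cutoff_bounds r x Hr ltac:(lra)).
      specialize (HN x); fold (f x) in HN.
      assert (0 <= Rabs (V1 x t - V2 x t)) by apply Rabs_pos.
      nra.
  - unfold minus, plus, opp; simpl.
    assert (A1 := atan_bound (r - x0)); assert (A2 := atan_bound (- r - x0)).
    assert (0 <= N).
    { specialize (HN x0); assert (0 <= Rabs (V1 x0 t - V2 x0 t)) by apply Rabs_pos.
      replace (N / (1 + (x0 - x0) ^ 2)) with N in HN by (field; apply one_plus_sq_neq_0); lra. }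
    nra.
Qed.

(** What matters is that [k] does not depend on [r], so that [r] can tend to
    infinity with [k] fixed. *)
Lemma weighted_gap_lower (V1 V2 : R -> R -> R) t x0 :
  (forall x, continuous (fun y => V1 y t) x) ->
  (forall x, continuous (fun y => V2 y t) x) ->
  V1 x0 t <> V2 x0 t ->
  exists k r0, 0 < k /\ 0 < r0 /\ forall r, r0 <= r -> k <= weighted_gap V1 V2 r t.
Proof.
  intros C1 C2 Hne.
  set (f := fun x => Rabs (V1 x t - V2 x t)).
  assert (Cf : forall x, continuous f x) by (intros; apply cont_abs, cont_minus; auto).
  assert (Pf : forall x, 0 <= f x) by (intros; apply Rabs_pos).
  assert (Pf0 : 0 < f x0) by (apply Rabs_pos_lt; lra).
  destruct (proj1 (filterlim_locally f (f x0)) (Cf x0)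
              (mkposreal (f x0 / 2) ltac:(lra))) as [d Hd].
  assert (P := cond_pos d).
  set (rho := d / 2).
  assert (Hlow : forall x, x0 - rho < x < x0 + rho -> f x0 / 2 <= f x).
  { intros x Hx.
    assert (B : Rabs (f x - f x0) < f x0 / 2).
    { apply Hd; change (Rabs (x - x0) < d); apply Rabs_def1; unfold rho in Hx; lra. }
    apply Rabs_def2 in B; lra. }
  exists (f x0 / 4 * (2 * rho)), (2 * (Rabs x0 + rho) + 1).
  assert (Prho : 0 < rho) by (unfold rho; lra).
  assert (0 <= Rabs x0) by apply Rabs_pos.
  assert (Hx0 : - Rabs x0 <= x0 <= Rabs x0) by (apply Rabs_le_between; lra).
  split; [nra | split; [lra |]]; intros r Hr.
  assert (Pr : 0 < r) by lra.
  assert (Iex : forall a b, is_RInt (fun x => f x * cutoff r x) a b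
                  (RInt (fun x => f x * cutoff r x) a b)).
  { intros a b; apply (RInt_correct (V := R_CompleteNormedModule)).
    now apply weighted_gap_ex_RInt. }
  set (I := fun a b => RInt (fun x => f x * cutoff r x) a b).
  assert (E : weighted_gap V1 V2 r t = I (- r) (x0 - rho) + I (x0 - rho) (x0 + rho) + I (x0 + rho) r).
  { unfold weighted_gap; apply (is_RInt_unique (V := R_CompleteNormedModule)).
    apply (is_RInt_Chasles (V := R_NormedModule)) with (x0 + rho); [| apply Iex].
    apply (is_RInt_Chasles (V := R_NormedModule)) with (x0 - rho); apply Iex. }
  assert (Ipos : forall a b, - r <= a -> a <= b -> b <= r -> 0 <= I a b).
  { intros a b Ha Hab Hb; apply (is_RInt_ge_0 _ a b _ Hab (Iex a b)).
    intros x Hx; apply Rmult_le_pos; [apply Pf | apply cutoff_bounds; lra]. }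
  assert (Imid : f x0 / 4 * (2 * rho) <= I (x0 - rho) (x0 + rho)).
  { replace (f x0 / 4 * (2 * rho)) with (scal ((x0 + rho) - (x0 - rho)) (f x0 / 4)).
    2:{ unfold scal; simpl; unfold mult; simpl; ring. }
    eapply is_RInt_le; [| apply (is_RInt_const (V := R_NormedModule)) | apply Iex |].
    - lra.
    - intros x Hx; specialize (Hlow x Hx).
      assert (1 / 2 <= cutoff r x) by (apply cutoff_half; lra).
      nra. }
  assert (I1 := Ipos (- r) (x0 - rho) ltac:(lra) ltac:(lra) ltac:(lra)).
  assert (I2 := Ipos (x0 + rho) r ltac:(lra) ltac:(lra) ltac:(lra)).
  lra.
Qed.

(** * Travelling waves and their combination *)

Lemma exp_le_lorentzian g y :
  0 < g -> 0 <= y -> exp (- g * y) <= (1 + 4 / g ^ 2) / (1 + y ^ 2).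
Proof.
  intros Hg Hy.
  assert (P := exp_pos (- g * y)).
  assert (E : exp (- g * y) * (exp (g * y / 2) * exp (g * y / 2)) = 1).
  { rewrite <- !exp_plus, <- exp_0; f_equal; field. }
  assert (L := exp_ineq1_le (g * y / 2)).
  assert (Hgy : 0 <= g * y) by nra.
  assert (Q : (1 + (g * y) ^ 2 / 4) * exp (- g * y) <= 1).
  { rewrite <- E, (Rmult_comm (exp (- g * y))).
    apply Rmult_le_compat_r; [lra |].
    apply Rle_trans with ((1 + g * y / 2) * (1 + g * y / 2)); [nra |].
    apply Rmult_le_compat; lra. }
  assert (H4 : 0 < 4 / g ^ 2) by (apply Rdiv_lt_0_compat; nra).
  assert (E4 : 4 / g ^ 2 * g ^ 2 = 4) by (field; lra).
  apply Rle_div_r; [nra |].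
  apply Rle_trans with ((1 + 4 / g ^ 2) * ((1 + (g * y) ^ 2 / 4) * exp (- g * y))).
  - rewrite (Rmult_comm (exp _)), <- Rmult_assoc.
    apply Rmult_le_compat_r; [lra |].
    assert (4 / g ^ 2 * ((g * y) ^ 2 / 4) = y ^ 2) by (field; lra).
    nra.
  - nra.
Qed.

(** [wave_gamma p l] is the smaller root of [z ^ 2 - l p z + (p - 1)]. *)
Lemma wave_gamma_spec p l :
  1 < p -> 1 < l ->
  0 < wave_gamma p l /\ wave_gamma p l ^ 2 + (p - 1) = l * p * wave_gamma p l.
Proof.
  intros Hp Hl; unfold wave_gamma.
  assert (Hlp : p < l * p) by nra.
  assert (D : 0 <= l ^ 2 * p ^ 2 - 4 * (p - 1)).
  { replace (l ^ 2 * p ^ 2) with ((l * p) * (l * p)) by ring.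
    assert (0 <= (p - 2) ^ 2) by apply pow2_ge_0. nra. }
  assert (E := sqrt_sqrt _ D); assert (P := sqrt_pos (l ^ 2 * p ^ 2 - 4 * (p - 1))).
  set (z := sqrt (l ^ 2 * p ^ 2 - 4 * (p - 1))) in *.
  assert (z < l * p).
  { replace (l ^ 2 * p ^ 2) with ((l * p) * (l * p)) in E by ring. nra. }
  split; [lra | nra].
Qed.

Lemma wave_tail p l v :
  wave_asymptotics p l v -> is_lim v p_infty 1 ->
  exists K X, 0 < K /\ forall x, X <= x ->
    1 / 2 <= v x /\ 1 - v x <= K * exp (- wave_gamma p l * x).
Proof.
  intros [_ [C [HC HA]]] Hv.
  apply is_lim_spec in HA; apply is_lim_spec in Hv.
  destruct (HA (mkposreal 1 Rlt_0_1)) as [X1 H1].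
  destruct (Hv (mkposreal (1 / 2) ltac:(lra))) as [X2 H2].
  exists (C + 1), (Rmax X1 X2 + 1); split; [lra |]; intros x Hx.
  assert (B1 := Rmax_l X1 X2); assert (B2 := Rmax_r X1 X2).
  specialize (H1 x ltac:(lra)); specialize (H2 x ltac:(lra)); simpl in H1, H2.
  apply Rabs_def2 in H2; apply Rabs_def2 in H1; destruct H1 as [_ H1].
  split; [lra |].
  set (e := exp (- wave_gamma p l * x)) in *.
  assert (Pe : 0 < e) by apply exp_pos.
  rewrite Rminus_0_r in H1; apply Rlt_div_r in H1; [lra | easy].
Qed.

(** The lower barrier [flower] as a function of the values [a] and [b] of the
    two waves; for fixed [a] it tends to [a] as [b] tends to [1]. *)
Definition glue (p a b : R) : R :=
  Rpower (Rpower a (1 - p) + Rpower b (1 - p) - 1) (- (1 / (p - 1))).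

Lemma glue_comm p a b : glue p a b = glue p b a.
Proof. unfold glue; f_equal; ring. Qed.

Lemma Rpower_nonpos_ge_1 z k : 0 < z <= 1 -> k <= 0 -> 1 <= Rpower z k.
Proof.
  intros Hz Hk; unfold Rpower.
  assert (ln z <= 0) by (rewrite <- ln_1; apply ln_le; lra).
  assert (L := exp_ineq1_le (k * ln z)); nra.
Qed.

(** By the mean value theorem in [b], starting from [glue p a 1 = a].  The
    derivative in [b] is [S^(-r-1) b^(-p)] with [r = 1 / (p - 1)] and
    [S = a^(1-p) + b^(1-p) - 1 >= 1]. *)
Lemma glue_gap p a b :
  1 < p -> 0 < a <= 1 -> 1 / 2 <= b <= 1 ->
  a - glue p a b <= Rpower 2 p * (1 - b).
Proof.
  intros Hp Ha Hb.
  set (r := 1 / (p - 1)).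
  set (S := fun z => Rpower a (1 - p) + Rpower z (1 - p) - 1).
  assert (Hr : r * (p - 1) = 1) by (unfold r; field; lra).
  assert (Pr : 0 < r) by (apply Rdiv_lt_0_compat; lra).
  assert (HS : forall z, 0 < z <= 1 -> 1 <= S z).
  { intros z Hz; unfold S.
    assert (A1 := Rpower_nonpos_ge_1 a (1 - p) Ha ltac:(lra)).
    assert (A2 := Rpower_nonpos_ge_1 z (1 - p) Hz ltac:(lra)); lra. }
  assert (E1 : glue p a 1 = a).
  { unfold glue; rewrite (Rpower_base_1 (1 - p)).
    replace (Rpower a (1 - p) + 1 - 1) with (Rpower a (1 - p)) by ring.
    rewrite Rpower_mult.
    replace ((1 - p) * - (1 / (p - 1))) with 1 by (field; lra).
    apply Rpower_1; lra. }
  destruct (proj2 Hb) as [Hb1 | ->]; [| rewrite E1; lra].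
  destruct (MVT_cor2 (glue p a)
    (fun z => Rpower (S z) (- r - 1) * Rpower z (- p)) b 1 Hb1) as [c [E Hc]].
  { intros c Hc; apply is_derive_Reals.
    assert (DS : is_derive S c ((1 - p) * Rpower c (1 - p - 1))).
    { unfold S; evar_last.
      - apply (is_derive_minus (fun z => Rpower a (1 - p) + Rpower z (1 - p)) (fun _ => 1));
          [| apply (is_derive_const (V := R_NormedModule))].
        apply (is_derive_plus (fun _ => Rpower a (1 - p)) (fun z => Rpower z (1 - p)));
          [apply (is_derive_const (V := R_NormedModule)) |].
        apply is_derive_Reals, derivable_pt_lim_power; lra.
      - unfold minus, plus, opp, zero; simpl; ring. }
    evar_last.
    - apply (is_derive_comp (fun y => Rpower y (- r)) S); [| exact DS].
      apply is_derive_Reals, derivable_pt_lim_power.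
      assert (Q := HS c ltac:(lra)); lra.
    - unfold scal; simpl; unfold mult; simpl.
      replace (1 - p - 1) with (- p) by ring.
      replace (1 - p) with (- (p - 1)) by ring.
      transitivity (r * (p - 1) * (Rpower (S c) (- r - 1) * Rpower c (- p))); [ring |].
      rewrite Hr; ring. }
  rewrite E1 in E; rewrite E.
  apply Rmult_le_compat_r; [lra |].
  assert (Hc1 : Rpower c (- p) <= Rpower 2 p).
  { unfold Rpower; apply exp_mono.
    assert (L : ln (1 / 2) <= ln c) by (apply ln_le; lra).
    replace (1 / 2) with (/ 2) in L by lra.
    rewrite ln_Rinv in L by lra.
    assert (0 <= p * (ln c + ln 2)) by (apply Rmult_le_pos; lra); lra. }
  assert (Hc2 : Rpower (S c) (- r - 1) <= 1).
  { assert (Q := HS c ltac:(lra)).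
    unfold Rpower; apply Rle_trans with (exp 0); [apply exp_mono | rewrite exp_0; lra].
    assert (L : ln 1 <= ln (S c)) by (apply ln_le; lra).
    rewrite ln_1 in L.
    assert (0 <= (r + 1) * ln (S c)) by (apply Rmult_le_pos; lra); lra. }
  assert (0 < Rpower c (- p)) by apply exp_pos.
  nra.
Qed.

(** If [a > 1] and [b] is close to [1], then [0 < a^(1-p) + b^(1-p) - 1 < b^(1-p)],
    and the decreasing power [-1/(p-1)] turns this into [glue p a b > b].
    Positivity of the base, which needs [b] close to [1], matters because
    [Rpower] takes no account of the size of a negative base. *)
Lemma glue_le_forces_le_1 p a b :
  1 < p -> 0 < a ->
  (forall z, 0 < b z) -> is_lim b p_infty 1 ->
  (forall X, exists z, X <= z /\ glue p a (b z) <= b z) ->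
  a <= 1.
Proof.
  intros Hp Ha Hb Hlim Hle.
  destruct (Rle_dec a 1) as [| Ha1]; [easy | exfalso].
  set (k := Rpower a (1 - p)).
  assert (Pk : 0 < k) by apply exp_pos.
  assert (Hk : k < 1).
  { unfold k, Rpower; apply Rlt_le_trans with (exp 0); [apply exp_increasing | rewrite exp_0; lra].
    assert (L : ln 1 < ln a) by (apply ln_increasing; lra).
    rewrite ln_1 in L; nra. }
  assert (Hlim2 : is_lim (fun z => Rpower (b z) (1 - p)) p_infty (Rpower 1 (1 - p))).
  { apply (is_lim_comp_continuous b (fun y => Rpower y (1 - p)) p_infty 1 Hlim).
    eapply is_derive_cont; apply is_derive_Reals, derivable_pt_lim_power; lra. }
  rewrite Rpower_base_1 in Hlim2.
  apply is_lim_spec in Hlim2.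
  destruct (Hlim2 (mkposreal k Pk)) as [X HX].
  destruct (Hle (X + 1)) as [z [Hz Hglue]].
  specialize (HX z ltac:(lra)); simpl in HX; apply Rabs_def2 in HX.
  revert Hglue; apply Rlt_not_le.
  set (B := Rpower (b z) (1 - p)) in *.
  assert (EB : Rpower B (- (1 / (p - 1))) = b z).
  { unfold B; rewrite Rpower_mult.
    replace ((1 - p) * - (1 / (p - 1))) with 1 by (field; lra).
    now apply Rpower_1. }
  rewrite <- EB at 1; unfold glue; fold k B.
  unfold Rpower; apply exp_increasing.
  assert (L : ln (k + B - 1) < ln B) by (apply ln_increasing; lra).
  assert (0 < 1 / (p - 1)) by (apply Rdiv_lt_0_compat; lra).
  nra.
Qed.

(** The argument of [b] is split into the distance [y] to a reference point, the
    position [c] of that point relative to the wave, and the shift [h]; the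
    bound is integrable in [y] and small like [exp (- g c)]. *)
Lemma glue_gap_tail p g K X b a y c h :
  1 < p -> 0 < g -> 0 < K ->
  (forall z, b z <= 1) ->
  (forall z, X <= z -> 1 / 2 <= b z /\ 1 - b z <= K * exp (- g * z)) ->
  0 < a <= 1 -> 0 <= y -> X <= c + h ->
  a - glue p a (b (y + c + h))
  <= Rpower 2 p * K * exp (- g * h) * (1 + 4 / g ^ 2) * exp (- g * c) / (1 + y ^ 2).
Proof.
  intros Hp Hg HK Hb1 Hb Ha Hy HX.
  destruct (Hb (y + c + h) ltac:(lra)) as [B1 B2].
  assert (P2 : 0 < Rpower 2 p) by apply exp_pos.
  assert (L := exp_le_lorentzian g y Hg Hy).
  apply Rle_trans with (Rpower 2 p * (1 - b (y + c + h))).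
  { apply glue_gap; auto. }
  apply Rle_trans with (Rpower 2 p * (K * exp (- g * (y + c + h)))).
  { apply Rmult_le_compat_l; lra. }
  replace (- g * (y + c + h)) with (- g * y + - g * c + - g * h) by ring.
  rewrite !exp_plus.
  set (e := Rpower 2 p * K * exp (- g * h) * exp (- g * c)).
  assert (0 < e).
  { unfold e; repeat apply Rmult_lt_0_compat; auto; apply exp_pos. }
  replace (Rpower 2 p * (K * (exp (- g * y) * exp (- g * c) * exp (- g * h))))
    with (e * exp (- g * y)) by (unfold e; ring).
  replace (Rpower 2 p * K * exp (- g * h) * (1 + 4 / g ^ 2) * exp (- g * c) / (1 + y ^ 2))
    with (e * ((1 + 4 / g ^ 2) / (1 + y ^ 2))) by (unfold e, Rdiv; ring).
  apply Rmult_le_compat_l; lra.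
Qed.

(** * The distance of two squeezed solutions at very negative times *)

Lemma ftime_le p q t : 0 < q -> t < 0 -> ftime p q t <= t.
Proof.
  intros Hq Ht; unfold ftime.
  assert (P := Rmult_lt_0_compat _ _ Hq (exp_pos ((p - 1) / p * t))); nra.
Qed.

Lemma mexp_bounds n : (3 <= n)%nat -> 0 < mexp n < 1.
Proof.
  intros hn; apply le_INR in hn; simpl in hn; unfold mexp.
  split; [apply Rdiv_lt_0_compat; lra |].
  apply Rlt_div_l; lra.
Qed.

(** The rate [k] for which both [gamma_l (x0 - l F) = - k F] and
    [gamma_l' (- x0 - l' F) = - k F] hold at the point [x0] where the two waves
    are, to leading order, equally close to [1] when the modified time is [F]. *)
Definition interaction_rate (p l l' : R) : R :=
  wave_gamma p l * wave_gamma p l' * (l + l') / (wave_gamma p l + wave_gamma p l').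

(** Substituting [l = (g ^ 2 + p - 1) / (p g)], and likewise [l'], turns the rate
    into [(p - 1) / p + g g' / p]. *)
Lemma interaction_rate_gt p l l' :
  1 < p -> 1 < l -> 1 < l' -> (p - 1) / p < interaction_rate p l l'.
Proof.
  intros Hp Hl Hl'.
  destruct (wave_gamma_spec p l Hp Hl) as [G E].
  destruct (wave_gamma_spec p l' Hp Hl') as [G' E'].
  unfold interaction_rate.
  set (g := wave_gamma p l) in *; set (g' := wave_gamma p l') in *.
  assert (El : l = (g ^ 2 + (p - 1)) / (p * g)) by (rewrite E; field; lra).
  assert (El' : l' = (g' ^ 2 + (p - 1)) / (p * g')) by (rewrite E'; field; lra).
  replace (g * g' * (l + l') / (g + g')) with ((p - 1) / p + g * g' / p).
  - assert (0 < g * g' / p) by (apply Rdiv_lt_0_compat; nra); lra.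
  - rewrite El, El'; field; lra.
Qed.

(** Both conclusions come from the squeeze alone.  The upper bound [1] holds
    because each wave is at most [1], by [glue_le_forces_le_1]; the decay comes
    from [|V1 - V2| <= Rmin A B - glue p A B], which is at most
    [A - glue p A B], small when [B] is close to [1], and symmetrically. *)
Lemma squeezed_gap_bound p q l l' h h' tb a b V1 V2 :
  1 < p -> 0 < q -> 1 < l -> 1 < l' ->
  (forall z, 0 < a z) -> (forall z, 0 < b z) ->
  is_lim a p_infty 1 -> is_lim b p_infty 1 ->
  wave_asymptotics p l a -> wave_asymptotics p l' b ->
  (forall x t, t < tb ->
     let A := a (x - l * ftime p q t + h) in
     let B := b (- x - l' * ftime p q t + h') in
     (glue p A B <= V1 x t <= Rmin A B) /\ (glue p A B <= V2 x t <= Rmin A B)) ->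
  (forall x t, t < tb -> V1 x t <= 1 /\ V2 x t <= 1) /\
  exists M S, 0 < M /\ forall s, s < S -> exists x0, forall x,
    Rabs (V1 x s - V2 x s) <= M * exp (interaction_rate p l l' * s) / (1 + (x - x0) ^ 2).
Proof.
  intros Hp Hq Hl Hl' Pa Pb La Lb Aa Ab HV.
  set (F := ftime p q) in *.
  assert (HF : forall t, t < 0 -> F t <= t) by (intros; now apply ftime_le).
  assert (Ple : forall x t, t < tb ->
    glue p (a (x - l * F t + h)) (b (- x - l' * F t + h'))
    <= Rmin (a (x - l * F t + h)) (b (- x - l' * F t + h'))).
  { intros x t Ht; destruct (HV x t Ht) as [[H1 H2] _].
    exact (Rle_trans _ _ _ H1 H2). }
  (* Both waves recede as time goes to minus infinity: from the point where one
     of them has a prescribed argument, the argument of the other is arbitrarily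
     large. *)
  assert (Hfar : forall c X, exists t, t < tb /\ X <= c - (l + l') * F t).
  { intros c X; set (t := Rmin (Rmin (tb - 1) (-1)) (- Rabs (c - X))).
    assert (M1 := Rmin_l (Rmin (tb - 1) (-1)) (- Rabs (c - X))).
    assert (M2 := Rmin_r (Rmin (tb - 1) (-1)) (- Rabs (c - X))).
    assert (M3 := Rmin_l (tb - 1) (-1)); assert (M4 := Rmin_r (tb - 1) (-1)).
    fold t in M1, M2.
    exists t; split; [lra |].
    assert (Ft := HF t ltac:(lra)).
    assert (Q : - Rabs (c - X) <= c - X) by (unfold Rabs; destruct Rcase_abs; lra).
    nra. }
  assert (a1 : forall y, a y <= 1).
  { intros y; apply (glue_le_forces_le_1 p (a y) b Hp (Pa y) Pb Lb); intros X.
    destruct (Hfar (h + h' - y) X) as [t [Ht HX]].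
    exists (h + h' - y - (l + l') * F t); split; [exact HX |].
    assert (Q := Ple (y + l * F t - h) t Ht).
    replace (y + l * F t - h - l * F t + h) with y in Q by ring.
    replace (- (y + l * F t - h) - l' * F t + h')
      with (h + h' - y - (l + l') * F t) in Q by ring.
    eapply Rle_trans; [exact Q | apply Rmin_r]. }
  assert (b1 : forall y, b y <= 1).
  { intros y; apply (glue_le_forces_le_1 p (b y) a Hp (Pb y) Pa La); intros X.
    destruct (Hfar (h + h' - y) X) as [t [Ht HX]].
    exists (h + h' - y - (l + l') * F t); split; [exact HX |].
    assert (Q := Ple (- y - l' * F t + h') t Ht).
    replace (- (- y - l' * F t + h') - l' * F t + h') with y in Q by ring.
    replace (- y - l' * F t + h' - l * F t + h)
      with (h + h' - y - (l + l') * F t) in Q by ring.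
    rewrite glue_comm; eapply Rle_trans; [exact Q | apply Rmin_l]. }
  split.
  { intros x t Ht; destruct (HV x t Ht) as [[_ H1] [_ H2]].
    assert (Q := Rmin_l (a (x - l * F t + h)) (b (- x - l' * F t + h'))).
    specialize (a1 (x - l * F t + h)); lra. }
  destruct (wave_gamma_spec p l Hp Hl) as [G _].
  destruct (wave_gamma_spec p l' Hp Hl') as [G' _].
  destruct (wave_tail p l a Aa La) as [K [X [HK Ta]]].
  destruct (wave_tail p l' b Ab Lb) as [K' [X' [HK' Tb]]].
  set (k := interaction_rate p l l').
  assert (Pk : 0 < k).
  { unfold k, interaction_rate; apply Rdiv_lt_0_compat; [| lra].
    apply Rmult_lt_0_compat; [now apply Rmult_lt_0_compat | lra]. }
  set (g := wave_gamma p l) in *; set (g' := wave_gamma p l') in *.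
  set (M := Rpower 2 p * K * exp (- g * h) * (1 + 4 / g ^ 2)).
  set (M' := Rpower 2 p * K' * exp (- g' * h') * (1 + 4 / g' ^ 2)).
  assert (PM : 0 < M).
  { assert (0 < 4 / g ^ 2) by (apply Rdiv_lt_0_compat; nra).
    unfold M; apply Rmult_lt_0_compat; [| lra].
    apply Rmult_lt_0_compat; [apply Rmult_lt_0_compat |]; [apply exp_pos | easy | apply exp_pos]. }
  assert (PM' : 0 < M').
  { assert (0 < 4 / g' ^ 2) by (apply Rdiv_lt_0_compat; nra).
    unfold M'; apply Rmult_lt_0_compat; [| lra].
    apply Rmult_lt_0_compat; [apply Rmult_lt_0_compat |]; [apply exp_pos | easy | apply exp_pos]. }
  exists (M + M'), (Rmin (Rmin tb 0) (Rmin (g * (h - X) / k) (g' * (h' - X') / k))).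
  split; [lra |]; intros s Hs.
  apply Rmin_Rgt in Hs; destruct Hs as [Hs1 Hs2].
  apply Rmin_Rgt in Hs1; apply Rmin_Rgt in Hs2.
  destruct Hs1 as [Htb H0]; destruct Hs2 as [HX HX'].
  assert (HFs := HF s H0).
  (* [x0] solves [g (x0 - l F) = g' (- x0 - l' F)]. *)
  set (x0 := (g * l - g' * l') * F s / (g + g')).
  assert (Ex : x0 - l * F s = - k * F s / g).
  { unfold x0, k, interaction_rate; fold g g'; field; lra. }
  assert (Ex' : - x0 - l' * F s = - k * F s / g').
  { unfold x0, k, interaction_rate; fold g g'; field; lra. }
  assert (Hexp : exp (k * F s) <= exp (k * s)) by (apply exp_mono; nra).
  assert (Hc : X <= - k * F s / g + h).
  { apply Rmult_gt_compat_r with (r := k) in HX; [| easy].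
    replace (g * (h - X) / k * k) with (g * (h - X)) in HX by (field; lra).
    apply Rmult_le_reg_l with g; [easy |].
    replace (g * (- k * F s / g + h)) with (- k * F s + g * h) by (field; lra); nra. }
  assert (Hc' : X' <= - k * F s / g' + h').
  { apply Rmult_gt_compat_r with (r := k) in HX'; [| easy].
    replace (g' * (h' - X') / k * k) with (g' * (h' - X')) in HX' by (field; lra).
    apply Rmult_le_reg_l with g'; [easy |].
    replace (g' * (- k * F s / g' + h')) with (- k * F s + g' * h') by (field; lra); nra. }
  exists x0; intros x.
  destruct (HV x s Htb) as [[L1 U1] [L2 U2]].
  set (A := a (x - l * F s + h)) in *; set (B := b (- x - l' * F s + h')) in *.
  assert (RA := Rmin_l A B); assert (RB := Rmin_r A B).
  assert (Psq : 0 < 1 + (x - x0) ^ 2) by (assert (Q := pow2_ge_0 (x - x0)); lra).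
  assert (Hside : forall N Z, 0 < N -> N <= M + M' ->
    Z <= N * exp (k * F s) / (1 + (x - x0) ^ 2) ->
    Z <= (M + M') * exp (k * s) / (1 + (x - x0) ^ 2)).
  { intros N Z PN HN HZ; eapply Rle_trans; [exact HZ |].
    apply Rmult_le_compat_r; [apply Rlt_le, Rinv_0_lt_compat, Psq |].
    apply Rmult_le_compat; [lra | apply Rlt_le, exp_pos | easy | easy]. }
  destruct (Rle_dec x x0) as [Hx | Hx].
  - apply Rle_trans with (A - glue p A B); [apply Rabs_le; lra |].
    apply (Hside M'); [easy | lra |].
    replace (x - x0) with (- (x0 - x)) by ring.
    replace ((- (x0 - x)) ^ 2) with ((x0 - x) ^ 2) by ring.
    replace (k * F s) with (- g' * (- k * F s / g')) by (field; lra).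
    unfold B; replace (- x - l' * F s + h') with ((x0 - x) + - k * F s / g' + h') by lra.
    apply (glue_gap_tail p g' K' X'); auto; [split; [apply Pa | apply a1] | lra].
  - apply Rle_trans with (B - glue p B A); [rewrite glue_comm; apply Rabs_le; lra |].
    apply (Hside M); [easy | lra |].
    replace (k * F s) with (- g * (- k * F s / g)) by (field; lra).
    unfold A; replace (x - l * F s + h) with ((x - x0) + - k * F s / g + h) by lra.
    apply (glue_gap_tail p g K X); auto; [split; [apply Pb | apply b1] | lra].
Qed.

(** * Uniqueness *)

(** If [V1] and [V2] differed somewhere at time [T], the weighted distance at
    [T] would stay above a positive constant for all large [r].  The gap bound at
    an early time [s] and the contraction from [s] to [T] make it smaller: [s]
    is fixed first, from the rate [k > 1 - m], and [r] afterwards, depending on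
    [s]. *)
Lemma ancient_uniqueness m (tb : R) V1 V2 k M S :
  0 < m < 1 ->
  solutionY m m_infty tb V1 -> solutionY m m_infty tb V2 ->
  (forall x t, t < tb -> V1 x t <= 1 /\ V2 x t <= 1) ->
  1 - m < k -> 0 < M ->
  (forall s, s < S -> exists x0, forall x,
     Rabs (V1 x s - V2 x s) <= M * exp (k * s) / (1 + (x - x0) ^ 2)) ->
  forall x t, t < tb -> V1 x t = V2 x t.
Proof.
  intros Hm S1 S2 HV Hk HM Hgap x T HT.
  assert (Ot : forall t, t < tb -> open_times m_infty tb t) by (intros t Ht; exact (conj I Ht)).
  destruct (solutionY_regular _ _ _ _ S1) as [v1t [u1x [R1 _]]].
  destruct (solutionY_regular _ _ _ _ S2) as [v2t [u2x [R2 _]]].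
  assert (C1 : forall t, t < tb -> forall x, continuous (fun y => V1 y t) x)
    by (intros t Ht y; apply continuity_2d_slice, R1, Ot, Ht).
  assert (C2 : forall t, t < tb -> forall x, continuous (fun y => V2 y t) x)
    by (intros t Ht y; apply continuity_2d_slice, R2, Ot, Ht).
  destruct (Req_dec (V1 x T) (V2 x T)) as [| Hne]; [easy | exfalso].
  destruct (weighted_gap_lower V1 V2 T x (C1 T HT) (C2 T HT) Hne)
    as [c [r0 [Hc [Hr0 Hlow]]]].
  set (a := 1 - m) in *.
  set (d := exp (- a * T) * c).
  assert (Pd : 0 < d) by (apply Rmult_lt_0_compat; [apply exp_pos | easy]).
  assert (PPI := PI_RGT_0).
  (* [s] makes the initial distance contribute at most [d / 2], and [r] makes
     the loss at the cutoff at most [d / 4]. *)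
  set (z := d / (2 * (M * PI))).
  assert (PMP : 0 < M * PI) by now apply Rmult_lt_0_compat.
  assert (Pz : 0 < z) by (apply Rdiv_lt_0_compat; lra).
  set (s := Rmin (Rmin (S - 1) T) (ln z / (k - a))).
  assert (Hs : s <= S - 1 /\ s <= T /\ s <= ln z / (k - a)).
  { assert (Q1 := Rmin_l (Rmin (S - 1) T) (ln z / (k - a))).
    assert (Q2 := Rmin_r (Rmin (S - 1) T) (ln z / (k - a))).
    assert (Q3 := Rmin_l (S - 1) T); assert (Q4 := Rmin_r (S - 1) T).
    fold s in Q1, Q2; lra. }
  destruct Hs as [HsS [HsT Hsz]].
  assert (Hz : exp ((k - a) * s) <= z).
  { rewrite <- (exp_ln z Pz); apply exp_mono.
    apply Rle_div_r in Hsz; lra. }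
  set (N := (T - s) * exp (- a * s) * 16).
  assert (HN : 0 <= N).
  { assert (P := exp_pos (- a * s)); unfold N; assert (0 <= (T - s) * exp (- a * s)) by nra; lra. }
  set (r := r0 + 4 * N / d).
  assert (H4 : 0 <= 4 * N / d) by (apply Rle_mult_inv_pos; lra).
  assert (Pr : 0 < r) by (unfold r; lra).
  assert (K := weighted_contraction m m_infty tb V1 V2 r s T Hm S1 S2
    (fun x t Ht => proj1 (HV x t (proj2 Ht))) (fun x t Ht => proj2 (HV x t (proj2 Ht)))
    Pr (Ot s ltac:(lra)) (Ot T HT) HsT).
  fold a in K.
  destruct (Hgap s ltac:(lra)) as [x0 Hx0].
  assert (U := weighted_gap_le V1 V2 r s _ x0 Pr (C1 s ltac:(lra)) (C2 s ltac:(lra)) Hx0).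
  specialize (Hlow r ltac:(unfold r; lra)).
  assert (L : d <= exp (- a * T) * weighted_gap V1 V2 r T).
  { apply Rmult_le_compat_l; [apply Rlt_le, exp_pos | easy]. }
  assert (U2 : exp (- a * s) * weighted_gap V1 V2 r s <= d / 2).
  { apply Rle_trans with (exp (- a * s) * (M * exp (k * s) * PI)).
    { apply Rmult_le_compat_l; [apply Rlt_le, exp_pos | easy]. }
    replace (exp (- a * s) * (M * exp (k * s) * PI)) with (exp ((k - a) * s) * (M * PI)).
    2:{ replace ((k - a) * s) with (- a * s + k * s) by ring; rewrite exp_plus; ring. }
    apply Rle_trans with (z * (M * PI)); [apply Rmult_le_compat_r; lra |].
    right; unfold z; field; split; lra. }
  assert (U3 : (T - s) * (exp (- a * s) * (16 / r)) <= d / 4).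
  { replace ((T - s) * (exp (- a * s) * (16 / r))) with (N / r) by (unfold N; field; lra).
    apply Rle_div_l; [easy |].
    assert (E : d / 4 * r = d / 4 * r0 + N) by (unfold r; field; lra).
    rewrite E; nra. }
  lra.
Qed.

Lemma jointly_continuous_final_time tb v x eps :
  jointly_continuous_on whole_line (fun t => t <= tb) v -> 0 < eps ->
  exists d, 0 < d /\ forall t, tb - d < t <= tb -> Rabs (v x t - v x tb) < eps.
Proof.
  intros Hc He.
  assert (Q := Hc (x, tb) (conj I (Rle_refl tb))).
  destruct (proj1 (filterlim_locally _ _) Q (mkposreal eps He)) as [d Hd].
  exists d; split; [apply cond_pos |]; intros t Ht.
  apply (Hd (x, t)).
  - split; [apply ball_center |].
    change (Rabs (t - tb) < d); apply Rabs_def1; assert (P := cond_pos d); simpl; lra.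
  - split; [exact I | apply Ht].
Qed.

Lemma eq_at_final_time tb V1 V2 :
  jointly_continuous_on whole_line (fun t => t <= tb) V1 ->
  jointly_continuous_on whole_line (fun t => t <= tb) V2 ->
  (forall x t, t < tb -> V1 x t = V2 x t) ->
  forall x, V1 x tb = V2 x tb.
Proof.
  intros H1 H2 H x.
  apply Rminus_diag_uniq, Rle_antisym; apply le_epsilon; intros e He.
  all: destruct (jointly_continuous_final_time tb V1 x (e / 2) H1 ltac:(lra)) as [d1 [P1 B1]].
  all: destruct (jointly_continuous_final_time tb V2 x (e / 2) H2 ltac:(lra)) as [d2 [P2 B2]].
  all: assert (Q1 := Rmin_l d1 d2); assert (Q2 := Rmin_r d1 d2).
  all: assert (Q3 := Rmin_pos d1 d2 P1 P2).
  all: set (t := tb - Rmin d1 d2 / 2).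
  all: specialize (B1 t ltac:(unfold t; lra)); specialize (B2 t ltac:(unfold t; lra)).
  all: rewrite (H x t ltac:(unfold t; lra)) in B1.
  all: apply Rabs_def2 in B1; apply Rabs_def2 in B2; lra.
Qed.

Theorem theorem3p11
  (n : nat) (hn : (3 <= n)%nat)
  (w : R -> R -> R)
  (hwave : forall l, 1 < l -> travelling_wave (mexp n) l (w l))
  (hasym : forall l, 1 < l -> wave_asymptotics (pexp n) l (w l))
  (k0 h0 h0' tau0' q tau0 : R)
  (hk0 : 0 < k0)
  (htau0' : k0 * exp ((pexp n - 1) / pexp n * tau0') < 1 / 2)
  (hq : 0 < q)
  (htau0 : tau0 < Rmin tau0' (- (pexp n / (pexp n - 1))))
  (hf' : forall t, t <= tau0 -> 0 < Derive (ftime (pexp n) q) t < 1)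
  (hsub : forall l l' h h', 1 < l -> 1 < l' -> h0 <= h -> h0' <= h' ->
     subsolutionY (mexp n) m_infty tau0 (flower (pexp n) q w l l' h h'))
  (l l' h h' : R)
  (hl : 1 < l) (hl' : 1 < l') (hh : h0 <= h) (hh' : h0' <= h')
  (taub0 : R) (htaub0 : taub0 < tau0)
  (hcross : forall t, t <= taub0 ->
     exists! xt : R, forall x,
       (x <= xt ->
          fupper (pexp n) q w l l' h h' x t
          = right_wave w l h x (ftime (pexp n) q t)) /\
       (xt <= x ->
          fupper (pexp n) q w l l' h h' x t
          = left_wave w l' h' x (ftime (pexp n) q t)))
  (V1 V2 : R -> R -> R)
  (hC1 : C21 whole_line (fun t => t <= taub0) V1)
  (hC2 : C21 whole_line (fun t => t <= taub0) V2)
  (hs1 : solutionY (mexp n) m_infty taub0 V1)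
  (hs2 : solutionY (mexp n) m_infty taub0 V2)
  (hV1 : forall x t, t < taub0 ->
     flower (pexp n) q w l l' h h' x t <= V1 x t
     <= fupper (pexp n) q w l l' h h' x t)
  (hV2 : forall x t, t < taub0 ->
     flower (pexp n) q w l l' h h' x t <= V2 x t
     <= fupper (pexp n) q w l l' h h' x t) :
  forall x t, t <= taub0 -> V1 x t = V2 x t.
Proof.
  assert (Hm := mexp_bounds n hn).
  assert (Hp : 1 < pexp n).
  { unfold pexp; rewrite <- Rinv_1; apply Rinv_lt_contravar; lra. }
  destruct (hwave l hl) as [_ [W [_ [_ Lw]]]].
  destruct (hwave l' hl') as [_ [W' [_ [_ Lw']]]].
  destruct (squeezed_gap_bound (pexp n) q l l' h h' taub0 (w l) (w l') V1 V2
    Hp hq hl hl' (fun z => proj1 (W z)) (fun z => proj1 (W' z)) Lw Lw'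
    (hasym l hl) (hasym l' hl')
    (fun x t Ht => conj (hV1 x t Ht) (hV2 x t Ht))) as [HV [M [S [HM Hgap]]]].
  assert (Hrate : 1 - mexp n < interaction_rate (pexp n) l l').
  { replace (1 - mexp n) with ((pexp n - 1) / pexp n) by (unfold pexp; field; lra).
    now apply interaction_rate_gt. }
  assert (Heq := ancient_uniqueness (mexp n) taub0 V1 V2 _ M S Hm hs1 hs2 HV Hrate HM Hgap).
  intros x t [Ht | ->]; [now apply Heq |].
  destruct hC1 as [? [? [? [_ [J1 _]]]]]; destruct hC2 as [? [? [? [_ [J2 _]]]]].
  now apply eq_at_final_time.
Qed.
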